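(* Let $\Delta t>0$ and let $k\ge0$ be an integer. The fully discrete split discontinuous Galerkin schemes with time integrators Scheme-5$(\Delta t)$ and Scheme-5F$(\Delta t)$ described in the context preserve the total particle number: if $f_h^{n+1}$ is produced from $(f_h^n,E_{1,h}^n,E_{2,h}^n,B_{3,h}^n)$ by one step of either scheme, then $$\int_{\Omega_{x_2}}\int_{\Omega_{v_2}}\int_{\Omega_{v_1}}f_h^{n+1}\,dv_1dv_2dx_2=\int_{\Omega_{x_2}}\int_{\Omega_{v_2}}\int_{\Omega_{v_1}}f_h^{n}\,dv_1dv_2dx_2.$$
   Context: Setting (1D2V Vlasov–Maxwell): unknowns $f(x_2,v_1,v_2,t)$, $E_1(x_2,t)$, $E_2(x_2,t)$, $B_3(x_2,t)$ with $f_t+v_2f_{x_2}+(E_1+v_2B_3)f_{v_1}+(E_2-v_1B_3)f_{v_2}=0$, $\partial_tB_3=\partial_{x_2}E_1$, $\partial_tE_1=\partial_{x_2}B_3-j_1$, $\partial_tE_2=-j_2$, $j_i=\iint fv_i\,dv_1dv_2$. Domain $\Omega_{x_2}\times\Omega_{v_1}\times\Omega_{v_2}=[0,L]\times[-V_{1,c},V_{1,c}]\times[-V_{2,c},V_{2,c}]$, periodic in $x_2$. Partition each interval into cells $K_{x_2,i}=[x_{2,i-1/2},x_{2,i+1/2}]$, $K_{v_1,j_1}=[v_{1,j_1-1/2},v_{1,j_1+1/2}]$, $K_{v_2,j_2}=[v_{2,j_2-1/2},v_{2,j_2+1/2}]$, and let $x_{2,i}^{(l)}$, $v_{1,j_1}^{(m_1)}$,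 $v_{2,j_2}^{(m_2)}$ ($l,m_1,m_2=1,\dots,k+1$) be the $k+1$ Gauss quadrature points of these cells. Spaces: $\mathcal{S}_h^k$: functions that on each cell $K_{x_2,i}\times K_{v_1,j_1}\times K_{v_2,j_2}$ are polynomials of degree $\le k$ in each of $x_2,v_1,v_2$; $\mathcal{W}_h^k$: piecewise polynomials of degree $\le k$ in $x_2$; $\mathcal{Z}_h^k$: functions of $(v_1,v_2)$ that on each $K_{v_1,j_1}\times K_{v_2,j_2}$ are polynomials of degree $\le k$ in each variable. States are $(f_h,E_{1,h},E_{2,h},B_{3,h})$ with $f_h\in\mathcal{S}_h^k$ and fields in $\mathcal{W}_h^k$. Superscripts $\pm$ at an interface denote right/left limits. Each map below takes the state at index $n$ to that at $n+1$ (beginning/end of the substep) with step size $\tau$ (possibly negative); for implicit equations the new state is any solution. A hat over a quantity denotes a numerical flux (see below). Scheme-a$(\tau)$: fields unchanged. For all $j_1,j_2,m_1,m_2$, find $g=g_{j_1,j_2}^{(m_1,m_2)}\in\mathcal{W}_h^k$ such that, with $f^n(x_2)=f_h^n(x_2,v_{1,j_1}^{(m_1)},v_{2,j_2}^{(m_2)})$, $\bar g=\frac12(g+f^n)$, $a=v_{2,j_2}^{(m_2)}$, for all $i$ and $\varphi\in\mathcal{W}_h^k$: $\int_{K_{x_2,i}}\frac{g-f^n}{\tau}\varphi\,dx_2-\int_{K_{x_2,i}}a\bar g\,\varphi_{x_2}\,dx_2+\widehat{a\bar g}_{i+1/2}\varphi^-_{i+1/2}-\widehat{a\bar g}_{i-1/2}\varphi^+_{i-1/2}=0$.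 Then $f_h^{n+1}\in\mathcal{S}_h^k$ is determined by $f_h^{n+1}(x_{2,i}^{(l)},v_{1,j_1}^{(m_1)},v_{2,j_2}^{(m_2)})=g_{j_1,j_2}^{(m_1,m_2)}(x_{2,i}^{(l)})$ for all indices. Velocity form: for $\bar g\in\mathcal{Z}_h^k$ and a velocity field $(a_1,a_2)$, where $a_1$ depends at most on $v_2$ and $a_2$ at most on $v_1$, define for test $\varphi\in\mathcal{Z}_h^k$ on cell $(j_1,j_2)$ $D_{j_1,j_2}(\bar g;a_1,a_2;\varphi)=-\int_{K_{v_2,j_2}}\int_{K_{v_1,j_1}}\bar g\,(a_1\varphi_{v_1}+a_2\varphi_{v_2})\,dv_1dv_2+\int_{K_{v_2,j_2}}a_1\big[\hat{\bar g}(v_{1,j_1+1/2},v_2)\varphi(v_{1,j_1+1/2}^-,v_2)-\hat{\bar g}(v_{1,j_1-1/2},v_2)\varphi(v_{1,j_1-1/2}^+,v_2)\big]dv_2+\int_{K_{v_1,j_1}}a_2\big[\hat{\bar g}(v_1,v_{2,j_2+1/2})\varphi(v_1,v_{2,j_2+1/2}^-)-\hat{\bar g}(v_1,v_{2,j_2-1/2})\varphi(v_1,v_{2,j_2-1/2}^+)\big]dv_1$. Scheme-b$(\tau)$: $B_{3,h}$ unchanged. For all $i,l$, find $g_i^{(l)}\in\mathcal{Z}_h^k$ and numbers $E_{1,i}^{(l)},E_{2,i}^{(l)}$ such that for all cells and $\varphi\in\mathcal{Z}_h^k$, $\int_{K_{v_2,j_2}}\int_{K_{v_1,j_1}}\frac{g_i^{(l)}-f_h^n(x_{2,i}^{(l)},\cdot)}{\tau}\varphi\,dv_1dv_2+D_{j_1,j_2}\big(\tfrac12(g_i^{(l)}+f_h^n(x_{2,i}^{(l)},\cdot));\bar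 E_1,\bar E_2;\varphi\big)=0$ with $\bar E_q=\frac12(E_{q,h}^n(x_{2,i}^{(l)})+E_{q,i}^{(l)})$, and $\frac{E_{q,i}^{(l)}-E_{q,h}^n(x_{2,i}^{(l)})}{\tau}=-\frac12\big(J_{q,h}^n(x_{2,i}^{(l)})+J_{q,i}^{(l)}\big)$, $q=1,2$, where $J_{q,h}^n(x_2)=\iint f_h^n(x_2,v_1,v_2)v_q\,dv_1dv_2$, $J_{q,i}^{(l)}=\iint g_i^{(l)}v_q\,dv_1dv_2$ over $\Omega_{v_1}\times\Omega_{v_2}$. Then $f_h^{n+1}\in\mathcal{S}_h^k$ and $E_{q,h}^{n+1}\in\mathcal{W}_h^k$ are determined by $f_h^{n+1}(x_{2,i}^{(l)},v_{1,j_1}^{(m_1)},v_{2,j_2}^{(m_2)})=g_i^{(l)}(v_{1,j_1}^{(m_1)},v_{2,j_2}^{(m_2)})$ and $E_{q,h}^{n+1}(x_{2,i}^{(l)})=E_{q,i}^{(l)}$. Scheme-c$(\tau)$: $E_{2,h}$ unchanged. Find $E_{1,h}^{n+1},B_{3,h}^{n+1}\in\mathcal{W}_h^k$ such that for all $i$ and $\varphi,\phi\in\mathcal{W}_h^k$, with $\bar E=\frac12(E_{1,h}^{n+1}+E_{1,h}^n)$, $\bar B=\frac12(B_{3,h}^{n+1}+B_{3,h}^n)$: $\int_{K_{x_2,i}}\frac{E_{1,h}^{n+1}-E_{1,h}^n}{\tau}\varphi\,dx_2=-\int_{K_{x_2,i}}\bar B\varphi_{x_2}\,dx_2+\hat{\bar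 B}_{i+1/2}\varphi^-_{i+1/2}-\hat{\bar B}_{i-1/2}\varphi^+_{i-1/2}$ and $\int_{K_{x_2,i}}\frac{B_{3,h}^{n+1}-B_{3,h}^n}{\tau}\phi\,dx_2=-\int_{K_{x_2,i}}\bar E\phi_{x_2}\,dx_2+\hat{\bar E}_{i+1/2}\phi^-_{i+1/2}-\hat{\bar E}_{i-1/2}\phi^+_{i-1/2}$. Then for all $i,l$, with $b=\bar B(x_{2,i}^{(l)})$, find $g_i^{(l)}\in\mathcal{Z}_h^k$ with $\int_{K_{v_1,j_1}}\int_{K_{v_2,j_2}}\frac{g_i^{(l)}-f_h^n(x_{2,i}^{(l)},\cdot)}{\tau}\varphi\,dv_2dv_1+D_{j_1,j_2}\big(\tfrac12(g_i^{(l)}+f_h^n(x_{2,i}^{(l)},\cdot));v_2b,-v_1b;\varphi\big)=0$ for all cells and $\varphi\in\mathcal{Z}_h^k$, and define $f_h^{n+1}\in\mathcal{S}_h^k$ by $f_h^{n+1}(x_{2,i}^{(l)},v_{1,j_1}^{(m_1)},v_{2,j_2}^{(m_2)})=g_i^{(l)}(v_{1,j_1}^{(m_1)},v_{2,j_2}^{(m_2)})$. Fluxes. Vlasov: central (average of the two one-sided limits) or upwind (pointwise along the interface, the left limit where the advection speed normal to the interface is $\ge0$, the right limit where it is $<0$); when the step size is negative, upwind is replaced by downwind (the opposite one-sided limit). Maxwell (in Scheme-c): central $\hat{\bar E}=\frac12(\bar E^++\bar E^-)$, $\hat{\bar B}=\frac12(\bar B^++\bar B^-)$, or alternating $\hat{\bar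 E}=\bar E^+,\hat{\bar B}=\bar B^-$, or $\hat{\bar E}=\bar E^-,\hat{\bar B}=\bar B^+$. Periodicity is used in $x_2$. Velocity boundary: standing assumption that $V_{1,c},V_{2,c}$ are so large that all numerical distribution functions vanish on the boundary of $\Omega_{v_1}\times\Omega_{v_2}$ and the velocity fluxes there are zero. Scheme-5$(\tau)=$ Scheme-a$(\tau/2)$ Scheme-b$(\tau/2)$ Scheme-c$(\tau)$ Scheme-b$(\tau/2)$ Scheme-a$(\tau/2)$ (composition). Scheme-5F$(\tau)=$ Scheme-5$(\beta_1\tau)$ Scheme-5$(\beta_2\tau)$ Scheme-5$(\beta_3\tau)$, $\beta_1=\beta_3=(2+2^{1/3}+2^{-1/3})/3$, $\beta_2=1-2\beta_1<0$. *)

(* Defs.v *)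
From HB Require Import structures.
From mathcomp Require Import all_boot all_order all_algebra.
From mathcomp Require Import all_classical all_reals all_analysis.

Set Implicit Arguments.
Unset Strict Implicit.
Unset Printing Implicit Defensive.

Import Order.TTheory GRing.Theory Num.Theory.
Import numFieldNormedType.Exports.

Local Open Scope classical_set_scope.
Local Open Scope ring_scope.

(* Cells are numbered from 0: cell i is [node i, node i.+1] for i < ncell, so
   that interface i - 1/2 is node i.  Values of [node] beyond ncell are
   irrelevant. *)
Record mesh (R : realType) (a b : R) := Mesh {
  ncell : nat;
  node : nat -> R;
  node_first : node 0 = a;
  node_last : node ncell = b;
  node_incr : forall i, (i < ncell)%N -> node i < node i.+1 }.

Definition cell (R : realType) (a b : R) (m : mesh a b) (i : nat) : set R :=
  `[node m i, node m i.+1]%classic.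

Definition in_cell (R : realType) (a b : R) (m : mesh a b) (i : nat) (x : R) :=
  (i < ncell m)%N /\ node m i < x < node m i.+1.

(* Rodrigues' formula *)
Definition legendre (R : realType) (n : nat) : {poly R} :=
  ((2 ^ n * n`!)%:R)^-1 *: (('X^2 - 1) ^+ n)^`(n).

(* The n Gauss quadrature points of [-1, 1] in increasing order. *)
Definition is_gauss_nodes (R : realType) (n : nat) (xi : 'I_n -> R) : Prop :=
  (forall l l' : 'I_n, (l < l')%N -> xi l < xi l') /\
  (forall l, -1 < xi l < 1 /\ root (legendre R n) (xi l)).

Inductive vlasov_flux := VCentral | VUpwind.

Inductive maxwell_flux := MCentral | MAlternatingEplus | MAlternatingEminus.

Record discretization (R : realType) (L V1c V2c : R) (k : nat) :=
  Discretization {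
    mx : mesh 0 L;
    m1 : mesh (- V1c) V1c;
    m2 : mesh (- V2c) V2c;
    xi : 'I_k.+1 -> R;
    xi_gauss : is_gauss_nodes xi;
    vflux : vlasov_flux;
    mflux : maxwell_flux }.

Definition gauss_pt (R : realType) (a b : R) (m : mesh a b) (n : nat)
    (xi : 'I_n -> R) (i : nat) (l : 'I_n) : R :=
  (node m i + node m i.+1) / 2 + (node m i.+1 - node m i) / 2 * xi l.

(* Discontinuous piecewise polynomials are actual functions; their values at
   the interfaces are left free, as only integrals, one-sided limits and values
   at Gauss points are ever used. *)
Definition Wspace (R : realType) (a b : R) (m : mesh a b) (k : nat)
    (g : R -> R) : Prop :=
  forall i, (i < ncell m)%N -> exists p : {poly R}, (size p <= k.+1)%N /\
    forall x, in_cell m i x -> g x = p.[x].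

Definition Zspace (R : realType) (a1 b1 a2 b2 : R) (m1 : mesh a1 b1)
    (m2 : mesh a2 b2) (k : nat) (g : R -> R -> R) : Prop :=
  forall j1 j2, (j1 < ncell m1)%N -> (j2 < ncell m2)%N ->
  exists c : 'I_k.+1 -> 'I_k.+1 -> R,
    forall v1 v2, in_cell m1 j1 v1 -> in_cell m2 j2 v2 ->
      g v1 v2 = \sum_(p < k.+1) \sum_(q < k.+1) c p q * v1 ^+ p * v2 ^+ q.

Definition Sspace (R : realType) (a0 b0 a1 b1 a2 b2 : R) (mx : mesh a0 b0)
    (m1 : mesh a1 b1) (m2 : mesh a2 b2) (k : nat)
    (f : R -> R -> R -> R) : Prop :=
  forall i j1 j2, (i < ncell mx)%N -> (j1 < ncell m1)%N -> (j2 < ncell m2)%N ->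
  exists c : 'I_k.+1 -> 'I_k.+1 -> 'I_k.+1 -> R,
    forall x v1 v2, in_cell mx i x -> in_cell m1 j1 v1 -> in_cell m2 j2 v2 ->
      f x v1 v2 = \sum_(o < k.+1) \sum_(p < k.+1) \sum_(q < k.+1)
                    c o p q * x ^+ o * v1 ^+ p * v2 ^+ q.

Definition llim (R : realType) (g : R -> R) (x : R) : R :=
  lim (g y @[y --> x^'-]).

Definition rlim (R : realType) (g : R -> R) (x : R) : R :=
  lim (g y @[y --> x^'+]).

(* One-sided limits at interface i, 0 <= i <= ncell, of a function extended
   periodically: interfaces 0 and ncell are identified. *)
Definition per_llim (R : realType) (a b : R) (m : mesh a b) (g : R -> R)
    (i : nat) : R :=
  llim g (node m (if i == 0%N then ncell m else i)).

Definition per_rlim (R : realType) (a b : R) (m : mesh a b) (g : R -> R)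
    (i : nat) : R :=
  rlim g (node m (if i == ncell m then 0%N else i)).

(* [gl], [gr] are the left and right limits, [a] is the advection speed and
   [tau] the step size, whose sign decides between upwind and downwind. *)
Definition vnumflux (R : realType) (vf : vlasov_flux) (tau a gl gr : R) : R :=
  match vf with
  | VCentral => (gl + gr) / 2
  | VUpwind => if 0 <= tau then (if 0 <= a then gl else gr)
               else (if 0 <= a then gr else gl)
  end.

(* Flux of g along one velocity direction at interface j; it is zero at the
   two ends of the velocity domain. *)
Definition velflux (R : realType) (vf : vlasov_flux) (tau : R) (b c : R)
    (m : mesh b c) (a : R) (g : R -> R) (j : nat) : R :=
  if (j == 0%N) || (j == ncell m) then 0
  else vnumflux vf tau a (llim g (node m j)) (rlim g (node m j)).

Definition Eflux (R : realType) (mf : maxwell_flux) (El Er : R) : R :=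
  match mf with
  | MCentral => (Er + El) / 2
  | MAlternatingEplus => Er
  | MAlternatingEminus => El
  end.

Definition Bflux (R : realType) (mf : maxwell_flux) (Bl Br : R) : R :=
  match mf with
  | MCentral => (Br + Bl) / 2
  | MAlternatingEplus => Bl
  | MAlternatingEminus => Br
  end.

(* Arguments of [dist_f] are x2, v1, v2, in this order. *)
Record state (R : realType) := State {
  dist_f : R -> R -> R -> R;
  field_E1 : R -> R;
  field_E2 : R -> R;
  field_B3 : R -> R }.

(* f vanishes on the boundary of the velocity domain, in the sense of traces. *)
Definition vanish_bdry (R : realType) (L V1c V2c : R) (k : nat)
    (D : discretization L V1c V2c k) (f : R -> R -> R -> R) : Prop :=
  forall i x, in_cell (mx D) i x ->
  (forall j2 v2, in_cell (m2 D) j2 v2 ->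
     rlim (fun v1 => f x v1 v2) (- V1c) = 0 /\
     llim (fun v1 => f x v1 v2) V1c = 0) /\
  (forall j1 v1, in_cell (m1 D) j1 v1 ->
     rlim (fun v2 => f x v1 v2) (- V2c) = 0 /\
     llim (fun v2 => f x v1 v2) V2c = 0).

Definition is_dg_state (R : realType) (L V1c V2c : R) (k : nat)
    (D : discretization L V1c V2c k) (s : state R) : Prop :=
  [/\ Sspace (mx D) (m1 D) (m2 D) k (dist_f s),
      [/\ Wspace (mx D) k (field_E1 s), Wspace (mx D) k (field_E2 s)
        & Wspace (mx D) k (field_B3 s)]
    & vanish_bdry D (dist_f s)].

Section Schemes.

Context (R : realType) (L V1c V2c : R) (k : nat).
Context (D : discretization L V1c V2c k).

Let mu := @lebesgue_measure R.

Let mx := mx D.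
Let m1 := m1 D.
Let m2 := m2 D.

Let gx i l := gauss_pt mx (xi D) i l.
Let g1 j l := gauss_pt m1 (xi D) j l.
Let g2 j l := gauss_pt m2 (xi D) j l.

Definition scheme_a (tau : R) (s s' : state R) : Prop :=
  [/\ is_dg_state D s, is_dg_state D s',
      [/\ field_E1 s' = field_E1 s, field_E2 s' = field_E2 s
        & field_B3 s' = field_B3 s] &
      forall j1 j2 (n1 n2 : 'I_k.+1),
      (j1 < ncell m1)%N -> (j2 < ncell m2)%N ->
      let fn x := dist_f s x (g1 j1 n1) (g2 j2 n2) in
      let a := g2 j2 n2 in
      exists g : R -> R,
      let gbar x := (g x + fn x) / 2 in
      let flux i := vnumflux (vflux D) tau a
                      (per_llim mx (fun x => a * gbar x) i)
                      (per_rlim mx (fun x => a * gbar x) i) in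
      [/\ Wspace mx k g,
          (forall i phi, (i < ncell mx)%N -> Wspace mx k phi ->
             (\int[mu]_(x in cell mx i) ((g x - fn x) / tau * phi x))
             - (\int[mu]_(x in cell mx i) (a * gbar x * derive1 phi x))
             + flux i.+1 * llim phi (node mx i.+1)
             - flux i * rlim phi (node mx i) = 0)
        & forall i l, (i < ncell mx)%N ->
            dist_f s' (gx i l) (g1 j1 n1) (g2 j2 n2) = g (gx i l)]].

(* The velocity field is (a1 v2, a2 v1). *)
Definition Dform (tau : R) (j1 j2 : nat) (gbar : R -> R -> R)
    (a1 a2 : R -> R) (phi : R -> R -> R) : R :=
  let F1 j v2 := velflux (vflux D) tau m1 (a1 v2) (fun v1 => gbar v1 v2) j in
  let F2 j v1 := velflux (vflux D) tau m2 (a2 v1) (fun v2 => gbar v1 v2) j in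
  - (\int[mu]_(v2 in cell m2 j2) \int[mu]_(v1 in cell m1 j1)
      (gbar v1 v2 * (a1 v2 * derive1 (fun w => phi w v2) v1
                     + a2 v1 * derive1 (fun w => phi v1 w) v2)))
  + (\int[mu]_(v2 in cell m2 j2)
      (a1 v2 * (F1 j1.+1 v2 * llim (fun v1 => phi v1 v2) (node m1 j1.+1)
                - F1 j1 v2 * rlim (fun v1 => phi v1 v2) (node m1 j1))))
  + (\int[mu]_(v1 in cell m1 j1)
      (a2 v1 * (F2 j2.+1 v1 * llim (fun v2 => phi v1 v2) (node m2 j2.+1)
                - F2 j2 v1 * rlim (fun v2 => phi v1 v2) (node m2 j2)))).

Definition velocity_integral (g : R -> R -> R) : R :=
  \int[mu]_(v2 in `[- V2c, V2c]) \int[mu]_(v1 in `[- V1c, V1c]) g v1 v2.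

Definition scheme_b (tau : R) (s s' : state R) : Prop :=
  [/\ is_dg_state D s, is_dg_state D s', field_B3 s' = field_B3 s &
      forall i (l : 'I_k.+1), (i < ncell mx)%N ->
      let x := gx i l in
      let fn := dist_f s x in
      exists (g : R -> R -> R) (E1 E2 : R),
      let E1bar := (field_E1 s x + E1) / 2 in
      let E2bar := (field_E2 s x + E2) / 2 in
      let gbar v1 v2 := (g v1 v2 + fn v1 v2) / 2 in
      [/\ Zspace m1 m2 k g,
          (forall j1 j2 phi, (j1 < ncell m1)%N -> (j2 < ncell m2)%N ->
             Zspace m1 m2 k phi ->
             (\int[mu]_(v2 in cell m2 j2) \int[mu]_(v1 in cell m1 j1)
                ((g v1 v2 - fn v1 v2) / tau * phi v1 v2))
             + Dform tau j1 j2 gbar (fun=> E1bar) (fun=> E2bar) phi = 0),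
          (E1 - field_E1 s x) / tau
            = - ((velocity_integral (fun v1 v2 => fn v1 v2 * v1)
                  + velocity_integral (fun v1 v2 => g v1 v2 * v1)) / 2) /\
          (E2 - field_E2 s x) / tau
            = - ((velocity_integral (fun v1 v2 => fn v1 v2 * v2)
                  + velocity_integral (fun v1 v2 => g v1 v2 * v2)) / 2),
          (forall j1 j2 (n1 n2 : 'I_k.+1),
             (j1 < ncell m1)%N -> (j2 < ncell m2)%N ->
             dist_f s' x (g1 j1 n1) (g2 j2 n2) = g (g1 j1 n1) (g2 j2 n2))
        & field_E1 s' x = E1 /\ field_E2 s' x = E2]].

Definition scheme_c (tau : R) (s s' : state R) : Prop :=
  let Ebar x := (field_E1 s' x + field_E1 s x) / 2 in
  let Bbar x := (field_B3 s' x + field_B3 s x) / 2 in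
  let Ehat i := Eflux (mflux D) (per_llim mx Ebar i) (per_rlim mx Ebar i) in
  let Bhat i := Bflux (mflux D) (per_llim mx Bbar i) (per_rlim mx Bbar i) in
  [/\ is_dg_state D s, is_dg_state D s', field_E2 s' = field_E2 s,
      forall i phi psi, (i < ncell mx)%N ->
        Wspace mx k phi -> Wspace mx k psi ->
        (\int[mu]_(x in cell mx i)
           ((field_E1 s' x - field_E1 s x) / tau * phi x))
          = - (\int[mu]_(x in cell mx i) (Bbar x * derive1 phi x))
            + Bhat i.+1 * llim phi (node mx i.+1)
            - Bhat i * rlim phi (node mx i) /\
        (\int[mu]_(x in cell mx i)
           ((field_B3 s' x - field_B3 s x) / tau * psi x))
          = - (\int[mu]_(x in cell mx i) (Ebar x * derive1 psi x))
            + Ehat i.+1 * llim psi (node mx i.+1)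
            - Ehat i * rlim psi (node mx i) &
      forall i (l : 'I_k.+1), (i < ncell mx)%N ->
      let x := gx i l in
      let fn := dist_f s x in
      let b := Bbar x in
      exists g : R -> R -> R,
      let gbar v1 v2 := (g v1 v2 + fn v1 v2) / 2 in
      [/\ Zspace m1 m2 k g,
          (forall j1 j2 phi, (j1 < ncell m1)%N -> (j2 < ncell m2)%N ->
             Zspace m1 m2 k phi ->
             (\int[mu]_(v1 in cell m1 j1) \int[mu]_(v2 in cell m2 j2)
                ((g v1 v2 - fn v1 v2) / tau * phi v1 v2))
             + Dform tau j1 j2 gbar (fun v2 => v2 * b) (fun v1 => - v1 * b) phi
             = 0)
        & forall j1 j2 (n1 n2 : 'I_k.+1),
            (j1 < ncell m1)%N -> (j2 < ncell m2)%N ->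
            dist_f s' x (g1 j1 n1) (g2 j2 n2) = g (g1 j1 n1) (g2 j2 n2)]].

Definition then_step (r r' : state R -> state R -> Prop) (s s' : state R) :
    Prop :=
  exists t, r s t /\ r' t s'.

Definition scheme5 (tau : R) : state R -> state R -> Prop :=
  then_step (scheme_a (tau / 2))
    (then_step (scheme_b (tau / 2))
      (then_step (scheme_c tau)
        (then_step (scheme_b (tau / 2)) (scheme_a (tau / 2))))).

Definition beta1 : R := (2 + 2 `^ (3^-1) + 2 `^ (- 3^-1)) / 3.
Definition beta2 : R := 1 - 2 * beta1.
Definition beta3 : R := beta1.

Definition scheme5F (tau : R) : state R -> state R -> Prop :=
  then_step (scheme5 (beta1 * tau))
    (then_step (scheme5 (beta2 * tau)) (scheme5 (beta3 * tau))).

Definition particle_number (f : R -> R -> R -> R) : R :=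
  \int[mu]_(x in `[0, L]) \int[mu]_(v2 in `[- V2c, V2c])
    \int[mu]_(v1 in `[- V1c, V1c]) f x v1 v2.

End Schemes.

Arguments particle_number {R} L V1c V2c f.

(* Main.v *)
(* Testing each cell equation with the constant 1 leaves only flux terms, and
   these telescope: periodically in x2, and to zero boundary fluxes in velocity.
   So a substep preserves the integral of its auxiliary unknown g, whereas the
   new state is only tied to g at the Gauss points.  As k + 1 points determine
   a polynomial of degree k, the integral over a cell is a fixed linear
   combination of nodal values, with Lagrange weights; hence the total particle
   number is a weighted sum of the nodal values of f, which turns the
   conservation of the integrals of the g's into the claim. *)
Require Import Defs.
From mathcomp Require Import all_boot all_order all_algebra.
From mathcomp Require Import all_classical all_reals all_analysis.
From mathcomp Require Import measurable_realfun zify ring lra.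

Set Implicit Arguments.
Unset Strict Implicit.
Unset Printing Implicit Defensive.

Import Order.TTheory GRing.Theory Num.Theory.
Import numFieldNormedType.Exports.
Local Open Scope classical_set_scope.
Local Open Scope ring_scope.

(** * Lagrange interpolation at distinct nodes over a field *)

Section Lagrange.
Variables (F : fieldType) (n : nat) (t : 'I_n -> F).

Definition lagrange_poly (l : 'I_n) : {poly F} :=
  \prod_(j < n | j != l) ((t l - t j)^-1 *: ('X - (t j)%:P)).

Hypothesis t_inj : injective t.

Lemma lagrange_poly_sample (l j : 'I_n) :
  (lagrange_poly l).[t j] = (l == j)%:R.
Proof.
rewrite horner_prod; case: eqVneq => [<-|lj].
  rewrite big1// => i il; rewrite !hornerE mulVf// subr_eq0.
  by apply: contra il => /eqP/t_inj ->.
by rewrite (bigD1 j) 1?eq_sym//= !hornerE subrr mulr0 mul0r.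
Qed.

(** A scalar multiple of a product of [n - 1] monic linear factors has size at most [n]. *)
Lemma size_lagrange_poly (l : 'I_n) : (size (lagrange_poly l) <= n)%N.
Proof.
rewrite /lagrange_poly scaler_prod (leq_trans (size_scale_leq _ _))//.
rewrite size_prod => [|j _]; last by rewrite polyXsubC_eq0.
under eq_bigr do rewrite size_XsubC.
have := cardC1 l; rewrite !card_ord sum_nat_const => ->.
by have := ltn_ord l; lia.
Qed.

(** The difference of the two sides vanishes at the [n] distinct nodes and has size at most [n], so
    it is zero. *)
Lemma lagrange_poly_expand (p : {poly F}) : (size p <= n)%N ->
  p = \sum_(l < n) p.[t l] *: lagrange_poly l.
Proof.
move=> pn; apply/eqP; rewrite -subr_eq0; apply/eqP.
set q := p - _; apply: (@roots_geq_poly_eq0 _ _ (codom t)).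
- apply/allP => _ /codomP[j ->]; rewrite /root !hornerE horner_sum subr_eq0.
  rewrite (bigD1 j)//= big1 => [|i ij]; rewrite hornerZ lagrange_poly_sample.
    by rewrite eqxx mulr1 addr0.
  by rewrite (negbTE ij) mulr0.
- by rewrite map_inj_uniq ?enum_uniq.
- rewrite size_codom card_ord (leq_trans (size_polyD _ _))// geq_max pn/=.
  rewrite size_polyN (leq_trans (size_sum _ _ _))//.
  apply/bigmax_leqP => i _.
  by rewrite (leq_trans (size_scale_leq _ _)) ?size_lagrange_poly.
Qed.

End Lagrange.

(** * Integrals of functions known only in the interior of an interval *)

Section Interior.
Variable R : realType.
Let mu := @lebesgue_measure R.

Lemma continuous_itv_integrable (a b : R) (h : R -> R) : continuous h ->
  mu.-integrable `[a, b] (EFin \o h).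
Proof.
move=> ch; apply: continuous_compact_integrable; first exact: segment_compact.
exact: continuous_subspaceT.
Qed.

(** Discontinuous piecewise polynomials have arbitrary values at interfaces, so [f] is controlled
    only on the open interval; the two endpoints form a null set. *)
Lemma interior_integrable (a b : R) (f h : R -> R) : continuous h ->
  (forall x, a < x < b -> f x = h x) ->
  mu.-integrable `[a, b] (EFin \o f).
Proof.
move=> /(continuous_itv_integrable a b) ih fh.
apply/(@negligible_integrable _ _ _ mu _ ([set a] `|` [set b])) => //.
- exact: measurableU.
(* Measurability on the closed interval is reduced to the open one by dropping one endpoint at a
   time. *)
- apply/measurable_EFinP/measurable_fun_itv_bndo_bndcP.
  apply/measurable_fun_itv_obnd_cbndP.
  apply: (eq_measurable_fun h).
    by move=> x; rewrite inE/= in_itv/= => /fh.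
  apply/measurable_EFinP; apply: (measurable_int mu).
  by apply: integrableS ih => //; exact: subset_itvW.
- by apply: countable_lebesgue_measure0; exact: finite_set_countable.
- apply: (@eq_integrable _ _ _ mu _ _ (EFin \o h)) => //.
  + by apply: measurableD => //; exact: measurableU.
  + move=> x; rewrite inE/= in_itv/= => -[/andP[ax xb] /not_orP[xa xb']].
    rewrite /= fh//; apply/andP; split; rewrite lt_neqAle ?ax ?xb andbT.
      by rewrite eq_sym; apply/eqP.
    by apply/eqP.
  + apply: integrableS ih => //.
    by apply: measurableD => //; exact: measurableU.
Qed.

Lemma Rintegral_interior (a b : R) (f h : R -> R) : continuous h ->
  (forall x, a < x < b -> f x = h x) ->
  \int[mu]_(x in `[a, b]) f x = \int[mu]_(x in `[a, b]) h x.
Proof.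
move=> ch fh.
have open_closed g : mu.-integrable `[a, b] (EFin \o g) ->
    \int[mu]_(x in `[a, b]) g x = \int[mu]_(x in `]a, b[) g x.
  move=> ig; rewrite -Rintegral_itv_bndo_bndc ?Rintegral_itv_obnd_cbnd//;
    by apply: integrableS ig => //; apply: subset_itvScc; rewrite bnd_simp.
rewrite !open_closed//; [|exact: continuous_itv_integrable|
  exact: interior_integrable fh].
by apply: eq_Rintegral => x; rewrite inE/= in_itv/= => /fh.
Qed.

Lemma integrable_setU (A B : set R) (f : R -> \bar R) :
  measurable A -> measurable B -> [disjoint A & B] ->
  mu.-integrable A f -> mu.-integrable B f -> mu.-integrable (A `|` B) f.
Proof.
move=> mA mB AB /integrableP[mfA fA] /integrableP[mfB fB].
have mf : measurable_fun (A `|` B) f by apply/measurable_funU.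
apply/integrableP; split => //; rewrite ge0_integral_setU//.
  by rewrite lte_add_pinfty.
exact: measurableT_comp.
Qed.

End Interior.

(** * Additivity of the integral over a mesh, and closure properties of [Wspace] *)

Section MeshFunctions.
Variables (R : realType) (a b : R) (m : mesh a b).
Let mu := @lebesgue_measure R.

Lemma node_ge (i : nat) : (i <= ncell m)%N -> a <= node m i.
Proof.
elim: i => [|i IH] im; first by rewrite node_first.
by rewrite (le_trans (IH (ltnW im)))// ltW// node_incr.
Qed.

Lemma Rintegral_mesh (f : R -> R) :
    (forall i, (i < ncell m)%N -> exists2 h : R -> R, continuous h &
      forall x, in_cell m i x -> f x = h x) ->
  \int[mu]_(x in `[a, b]) f x
    = \sum_(i < ncell m) \int[mu]_(x in cell m i) f x.
Proof.
move=> fcont; rewrite -[b in LHS](node_last m).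
(* Integrability on the first [n] cells is part of the induction, since additivity of the integral
   over a union requires it. *)
suff upto n : (n <= ncell m)%N ->
    mu.-integrable `[a, node m n] (EFin \o f) /\
    \int[mu]_(x in `[a, node m n]) f x
      = \sum_(i < n) \int[mu]_(x in cell m i) f x.
  by have [] := upto _ (leqnn _).
elim: n => [_|n IH nm].
  rewrite node_first set_itv1 Rintegral_set1 big_ord0; split => //.
  apply: null_set_integrable => //; last exact: countable_lebesgue_measure0.
  exact: measurable_fun_set1.
have {IH}[fn fnE] := IH (ltnW nm).
have [h hcont fh] := fcont _ nm.
have fhn x : node m n < x < node m n.+1 -> f x = h x by move=> ?; exact: fh.
have fcell := interior_integrable hcont fhn.
(* The new cell loses its left endpoint, which makes the union disjoint without changing the
   integral. *)
have foc : mu.-integrable `]node m n, node m n.+1] (EFin \o f).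
  by apply: integrableS fcell => //; apply: subset_itvScc; rewrite bnd_simp.
have disj : [disjoint `[a, node m n] & `]node m n, node m n.+1]].
  apply/disj_setPS => x [] /=.
  rewrite !in_itv/= => /andP[_ xn] /andP[nx _].
  by rewrite ltNge xn in nx.
have -> : `[a, node m n.+1]%classic
    = `[a, node m n] `|` `]node m n, node m n.+1].
  by rewrite -itv_bndbnd_setU ?bnd_simp ?node_ge ?ltW ?node_incr// ltnW.
have fU := integrable_setU _ _ disj fn foc.
split; first exact: fU.
rewrite Rintegral_setU//; last exact: fU.
by rewrite fnE big_ord_recr/= Rintegral_itv_obnd_cbnd.
Qed.

Section Wspace.
Variable k : nat.

Lemma Wspace_eq (g h : R -> R) :
  (forall i x, in_cell m i x -> g x = h x) -> Wspace m k h -> Wspace m k g.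
Proof.
move=> gh hW i im; have [p [pk hp]] := hW i im.
by exists p; split => // x xi; rewrite (gh i)// hp.
Qed.

Lemma Wspace_cst (c : R) : Wspace m k (fun=> c).
Proof.
move=> i im; exists c%:P; split=> [|x _]; last by rewrite hornerC.
by rewrite size_polyC; case: (c != 0).
Qed.

Lemma WspaceD (g h : R -> R) : Wspace m k g -> Wspace m k h ->
  Wspace m k (fun x => g x + h x).
Proof.
move=> gW hW i im; have [p [pk gp]] := gW i im; have [q [qk hq]] := hW i im.
exists (p + q); split=> [|x xi]; last by rewrite hornerD gp// hq.
by rewrite (leq_trans (size_polyD _ _))// geq_max pk.
Qed.

Lemma WspaceZ (c : R) (g : R -> R) : Wspace m k g ->
  Wspace m k (fun x => c * g x).
Proof.
move=> gW i im; have [p [pk gp]] := gW i im.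
exists (c *: p); split=> [|x xi]; last by rewrite hornerZ gp.
by rewrite (leq_trans (size_scale_leq _ _)).
Qed.

Lemma Wspace_sum (I : Type) (r : seq I) (g : I -> R -> R) :
  (forall j, Wspace m k (g j)) -> Wspace m k (fun x => \sum_(j <- r) g j x).
Proof.
move=> gW; elim: r => [|j r IH].
  apply: (Wspace_eq (h := fun=> 0)) => [i x _|]; first by rewrite big_nil.
  exact: Wspace_cst.
apply: (Wspace_eq (h := fun x => g j x + \sum_(i <- r) g i x)).
  by move=> i x _; rewrite big_cons.
exact: WspaceD.
Qed.

Lemma Wspace_continuous (g : R -> R) : Wspace m k g ->
  forall i, (i < ncell m)%N -> exists2 h : R -> R, continuous h &
    forall x, in_cell m i x -> g x = h x.
Proof.
move=> gW i im; have [p [_ gp]] := gW i im.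
by exists (horner p) => //; exact: continuous_horner.
Qed.

End Wspace.

End MeshFunctions.

(** * Interpolatory quadrature at the Gauss points *)

Section Quadrature.
Variables (R : realType) (a b : R) (m : mesh a b).
Let mu := @lebesgue_measure R.
Variables (k : nat) (xi : 'I_k.+1 -> R).

(** With the integrals of the Lagrange basis as weights, exactness up to degree [k] follows from
    interpolation alone. *)
Definition quad_weight (i : nat) (l : 'I_k.+1) : R :=
  \int[mu]_(x in cell m i) (lagrange_poly (gauss_pt m xi i) l).[x].

Definition cell_quad (i : nat) (g : R -> R) : R :=
  \sum_(l < k.+1) quad_weight i l * g (gauss_pt m xi i l).

Definition quad (g : R -> R) : R := \sum_(i < ncell m) cell_quad i g.

Hypothesis xi_gauss : is_gauss_nodes xi.

Lemma gauss_pt_in_cell (i : nat) (l : 'I_k.+1) : (i < ncell m)%N ->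
  in_cell m i (gauss_pt m xi i l).
Proof.
move=> im; split=> //; have [_ /(_ l)[/andP[lo hi] _]] := xi_gauss.
have := node_incr im; rewrite /gauss_pt; set u := node m i; set v := node m _.
by move=> uv; apply/andP; split; nra.
Qed.

(** The affine map onto a cell has nonzero slope, and the reference points are strictly
    increasing. *)
Lemma gauss_pt_inj (i : nat) : (i < ncell m)%N ->
  injective (gauss_pt m xi i).
Proof.
move=> im l l' /addrI/mulfI.
rewrite mulf_neq0 ?invr_eq0 ?pnatr_eq0//; last first.
  by rewrite subr_eq0 gt_eqF// node_incr.
move=> /(_ isT) ll'; apply/val_inj; have [incr _] := xi_gauss.
by case: (ltngtP l l') => // /incr; rewrite ll' ltxx.
Qed.

(** On the cell [g] is a polynomial of degree at most [k], hence equal to its Lagrange interpolant;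
    integrating that term by term yields the weights. *)
Lemma cell_quadE (g : R -> R) (i : nat) : (i < ncell m)%N -> Wspace m k g ->
  \int[mu]_(x in cell m i) g x = cell_quad i g.
Proof.
move=> im /(_ i im)[p [pk gp]].
have gpt l : g (gauss_pt m xi i l) = p.[gauss_pt m xi i l].
  by apply: gp; exact: gauss_pt_in_cell.
have ch (q : {poly R}) : continuous (horner q) by exact: continuous_horner.
rewrite /cell (Rintegral_interior (ch p)); last by move=> x ?; exact: gp.
rewrite {1}(lagrange_poly_expand (gauss_pt_inj im) pk) /cell_quad.
under [RHS]eq_bigr do rewrite gpt.
(* A simultaneous induction on the interpolant and on the quadrature sum carries the integral
   through the sum. *)
elim/big_rec2: _ => [|l y q _ <-].
  under eq_Rintegral do rewrite horner0.
  by rewrite Rintegral_cst// mul0r.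
under eq_Rintegral do rewrite hornerD hornerZ.
rewrite RintegralD ?RintegralZl//; first by rewrite mulrC.
- exact: continuous_itv_integrable.
- rewrite (_ : _ \o _ = EFin \o horner
    (p.[gauss_pt m xi i l] *: lagrange_poly (gauss_pt m xi i) l)).
    exact: continuous_itv_integrable.
  by apply/funext => x /=; rewrite hornerZ.
- exact: continuous_itv_integrable.
Qed.

Lemma quadE (g : R -> R) : Wspace m k g ->
  \int[mu]_(x in `[a, b]) g x = quad g.
Proof.
move=> gW; rewrite (Rintegral_mesh (Wspace_continuous gW)).
by apply: eq_bigr => i _; exact: cell_quadE.
Qed.

Lemma eq_cell_quad (g h : R -> R) (i : nat) : (i < ncell m)%N ->
  (forall l, g (gauss_pt m xi i l) = h (gauss_pt m xi i l)) ->
  cell_quad i g = cell_quad i h.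
Proof. by move=> im gh; apply: eq_bigr => l _; rewrite gh. Qed.

Lemma eq_quad (g h : R -> R) :
  (forall i l, (i < ncell m)%N ->
    g (gauss_pt m xi i l) = h (gauss_pt m xi i l)) ->
  quad g = quad h.
Proof.
by move=> gh; apply: eq_bigr => i _; apply: eq_cell_quad => // l; exact: gh.
Qed.

Lemma Wspace_cell_quad (a' b' : R) (m' : mesh a' b') (g : R -> R -> R)
    (i : nat) : (forall l, Wspace m' k (fun y => g y (gauss_pt m xi i l))) ->
  Wspace m' k (fun y => cell_quad i (g y)).
Proof.
by move=> gW; apply: Wspace_sum => l; exact: WspaceZ.
Qed.

(** A quadrature in one variable is a finite linear combination of slices in the other, so it stays
    in the piecewise polynomial space and can be integrated exactly in turn. *)
Lemma Wspace_quad (a' b' : R) (m' : mesh a' b') (g : R -> R -> R) :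
  (forall i l, (i < ncell m)%N ->
    Wspace m' k (fun y => g y (gauss_pt m xi i l))) ->
  Wspace m' k (fun y => quad (g y)).
Proof.
move=> gW; apply: Wspace_sum => i.
by apply: Wspace_cell_quad => l; exact: gW.
Qed.

End Quadrature.

(** * Linearity of quadrature and exchange of iterated quadratures *)

Section QuadratureLinear.
Variables (R : realType) (a b : R) (m : mesh a b) (k : nat) (xi : 'I_k.+1 -> R).

Lemma cell_quad_sum (I : Type) (r : seq I) (g : I -> R -> R) (i : nat) :
  cell_quad m xi i (fun x => \sum_(j <- r) g j x)
    = \sum_(j <- r) cell_quad m xi i (g j).
Proof.
by rewrite /cell_quad exchange_big/=; apply: eq_bigr => l _; rewrite big_distrr.
Qed.

Lemma cell_quadZ (c : R) (g : R -> R) (i : nat) :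
  cell_quad m xi i (fun x => c * g x) = c * cell_quad m xi i g.
Proof.
by rewrite /cell_quad big_distrr; apply: eq_bigr => l _; rewrite mulrCA.
Qed.

Lemma cell_quadB (g h : R -> R) (i : nat) :
  cell_quad m xi i (fun x => g x - h x)
    = cell_quad m xi i g - cell_quad m xi i h.
Proof.
by rewrite /cell_quad -sumrB; apply: eq_bigr => l _; rewrite mulrBr.
Qed.

End QuadratureLinear.

Lemma quad_iterated (R : realType) (a b a' b' : R) (k : nat) (xi : 'I_k.+1 -> R)
    (m : mesh a b) (m' : mesh a' b') (g : R -> R -> R) :
  quad m xi (fun x => quad m' xi (g x))
    = \sum_(i < ncell m) \sum_(j < ncell m') cell_quad m xi i
        (fun x => cell_quad m' xi j (g x)).
Proof. by apply: eq_bigr => i _; rewrite -cell_quad_sum. Qed.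

Lemma cell_quad_swap (R : realType) (a b a' b' : R) (k : nat)
    (xi : 'I_k.+1 -> R) (m : mesh a b) (m' : mesh a' b') (g : R -> R -> R)
    (i j : nat) :
  cell_quad m xi i (fun x => cell_quad m' xi j (g x))
    = cell_quad m' xi j (fun y => cell_quad m xi i (g^~ y)).
Proof.
rewrite /cell_quad; under eq_bigr do rewrite mulr_sumr.
under [RHS]eq_bigr do rewrite mulr_sumr.
rewrite exchange_big/=; apply: eq_bigr => l _; apply: eq_bigr => l' _.
by rewrite mulrCA.
Qed.

(** For finite weighted sums, Fubini is an exchange of summations. *)
Lemma quad_swap (R : realType) (a b a' b' : R) (k : nat) (xi : 'I_k.+1 -> R)
    (m : mesh a b) (m' : mesh a' b') (g : R -> R -> R) :
  quad m xi (fun x => quad m' xi (g x))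
    = quad m' xi (fun y => quad m xi (g^~ y)).
Proof.
rewrite !quad_iterated exchange_big/=.
by apply: eq_bigr => j _; apply: eq_bigr => i _; exact: cell_quad_swap.
Qed.

(** * One-sided limits at interfaces and the numerical flux *)

Section Traces.
Variables (R : realType).

(** Points close enough to the right node, on its left, lie in the open cell, where [g] agrees with
    the continuous function [p]. *)
Lemma llim_cell (a b : R) (m : mesh a b) (i : nat) (g : R -> R) (p : {poly R}) :
  (i < ncell m)%N -> (forall x, in_cell m i x -> g x = p.[x]) ->
  llim g (node m i.+1) = p.[node m i.+1].
Proof.
move=> im gp; apply/cvg_lim => //.
have : p.[y] @[y --> (node m i.+1)^'-] --> p.[node m i.+1].
  by apply: cvg_at_left_filter; exact: continuous_horner.
apply: cvg_trans; apply: near_eq_cvg; near=> y; rewrite gp//; split => //.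
apply/andP; split; last by near: y; exact: nbhs_left_lt.
by near: y; apply: nbhs_left_gt; exact: node_incr.
Unshelve. all: by end_near. Qed.

Lemma rlim_cell (a b : R) (m : mesh a b) (i : nat) (g : R -> R) (p : {poly R}) :
  (i < ncell m)%N -> (forall x, in_cell m i x -> g x = p.[x]) ->
  rlim g (node m i) = p.[node m i].
Proof.
move=> im gp; apply/cvg_lim => //.
have : p.[y] @[y --> (node m i)^'+] --> p.[node m i].
  by apply: cvg_at_right_filter; exact: continuous_horner.
apply: cvg_trans; apply: near_eq_cvg; near=> y; rewrite gp//; split => //.
apply/andP; split; first by near: y; exact: nbhs_right_gt.
by near: y; apply: nbhs_right_lt; exact: node_incr.
Unshelve. all: by end_near. Qed.

Lemma llim_cst (c x : R) : llim (fun=> c) x = c.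
Proof. by apply/cvg_lim => //; exact: cvg_cst. Qed.

Lemma rlim_cst (c x : R) : rlim (fun=> c) x = c.
Proof. by apply/cvg_lim => //; exact: cvg_cst. Qed.

(* The upwind choice itself is discontinuous in the speed [a], but its product
   with [a] is not. *)
Lemma mul_vnumflux (vf : vlasov_flux) (tau : R) : exists c1 c2 c3 c4 : R,
  forall a gl gr, a * vnumflux vf tau a gl gr
    = (c1 * a + c2 * `|a|) * gl + (c3 * a + c4 * `|a|) * gr.
Proof.
case: vf; first by exists 2^-1, 0, 2^-1, 0 => a gl gr /=; field.
have [t0|t0] := leP 0 tau.
  exists 2^-1, 2^-1, 2^-1, (- 2^-1) => a gl gr /=; rewrite t0.
  by have [a0|a0] := leP 0 a;
    [rewrite ger0_norm|rewrite ltr0_norm] => //; field.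
exists 2^-1, (- 2^-1), 2^-1, 2^-1 => a gl gr /=; rewrite leNgt t0/=.
by have [a0|a0] := leP 0 a; [rewrite ger0_norm|rewrite ltr0_norm] => //; field.
Qed.

End Traces.

(** * Slices, traces and closure properties of the space in both velocities *)

Section Planar.
Variables (R : realType) (a1 b1 a2 b2 : R) (m1 : mesh a1 b1) (m2 : mesh a2 b2).
Variable k : nat.

(** A tensor polynomial is read as a polynomial in [v1] with coefficients depending on [v2]. The
    last clause covers every [y], so that it applies at interface nodes, outside the open cell. *)
Lemma Zspace_cell (g : R -> R -> R) (j1 j2 : nat) :
  Zspace m1 m2 k g -> (j1 < ncell m1)%N -> (j2 < ncell m2)%N ->
  exists P : R -> {poly R},
  [/\ forall v2, (size (P v2) <= k.+1)%N,
      forall v1 v2, in_cell m1 j1 v1 -> in_cell m2 j2 v2 ->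
        g v1 v2 = (P v2).[v1]
    & forall y, exists2 r : {poly R}, (size r <= k.+1)%N &
        forall v2, (P v2).[y] = r.[v2]].
Proof.
move=> gZ j1m j2m; have [c gc] := gZ j1 j2 j1m j2m.
exists (fun v2 => \poly_(p < k.+1) \sum_(q < k.+1) c (inord p) q * v2 ^+ q).
split=> [v2|v1 v2 v1j v2j|y]; first exact: size_poly.
  rewrite gc// horner_poly; apply: eq_bigr => p _; rewrite inord_val mulr_suml.
  by apply: eq_bigr => q _; rewrite mulrAC.
(* The same coefficient table, now collected by powers of [v2]. *)
exists (\poly_(q < k.+1) \sum_(p < k.+1) c p (inord q) * y ^+ p).
  exact: size_poly.
move=> v2; rewrite !horner_poly; under eq_bigr do rewrite mulr_suml.
under [RHS]eq_bigr do rewrite mulr_suml.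
rewrite exchange_big/=; apply: eq_bigr => q _; apply: eq_bigr => p _.
by rewrite !inord_val mulrAC.
Qed.

Lemma Zspace_row (g : R -> R -> R) (j2 : nat) (v2 : R) :
  Zspace m1 m2 k g -> in_cell m2 j2 v2 -> Wspace m1 k (g^~ v2).
Proof.
move=> gZ v2j j1 j1m; have [P [Pk gP _]] := Zspace_cell gZ j1m v2j.1.
by exists (P v2); split=> // v1 v1j; exact: gP.
Qed.

Lemma Zspace_llim (g : R -> R -> R) (j : nat) : (j < ncell m1)%N ->
  Zspace m1 m2 k g -> Wspace m2 k (fun v2 => llim (g^~ v2) (node m1 j.+1)).
Proof.
move=> jm gZ j2 j2m; have [P [_ gP /(_ (node m1 j.+1))[r rk Pr]]] :=
  Zspace_cell gZ jm j2m.
exists r; split=> // v2 v2j.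
by rewrite (llim_cell (p := P v2) jm)// => v1 v1j; exact: gP.
Qed.

Lemma Zspace_rlim (g : R -> R -> R) (j : nat) : (j < ncell m1)%N ->
  Zspace m1 m2 k g -> Wspace m2 k (fun v2 => rlim (g^~ v2) (node m1 j)).
Proof.
move=> jm gZ j2 j2m; have [P [_ gP /(_ (node m1 j))[r rk Pr]]] :=
  Zspace_cell gZ jm j2m.
exists r; split=> // v2 v2j.
by rewrite (rlim_cell (p := P v2) jm)// => v1 v1j; exact: gP.
Qed.

Lemma Zspace_swap (g : R -> R -> R) :
  Zspace m1 m2 k g -> Zspace m2 m1 k (fun v2 v1 => g v1 v2).
Proof.
move=> gZ j2 j1 j2m j1m; have [c gc] := gZ j1 j2 j1m j2m.
exists (fun q p => c p q) => v2 v1 v2j v1j; rewrite gc// exchange_big/=.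
by apply: eq_bigr => q _; apply: eq_bigr => p _; rewrite mulrAC.
Qed.

Lemma Zspace_eq (g h : R -> R -> R) : (forall v1 v2, g v1 v2 = h v1 v2) ->
  Zspace m1 m2 k h -> Zspace m1 m2 k g.
Proof. by move=> gh; congr Zspace; apply/funext => v1; apply/funext. Qed.

Lemma Zspace_cst (c : R) : Zspace m1 m2 k (fun _ _ => c).
Proof.
move=> j1 j2 _ _.
exists (fun p q => if (p == ord0) && (q == ord0) then c else 0).
move=> v1 v2 _ _; rewrite (bigD1 ord0)//= [X in _ + X]big1 => [|p /negbTE p0].
  rewrite (bigD1 ord0)//= big1 => [|q /negbTE q0]; last by rewrite q0 !mul0r.
  by rewrite !mulr1 !addr0.
by rewrite big1// => q _; rewrite p0 !mul0r.
Qed.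

Lemma Zspace_lin (x y : R) (g h : R -> R -> R) :
  Zspace m1 m2 k g -> Zspace m1 m2 k h ->
  Zspace m1 m2 k (fun v1 v2 => x * g v1 v2 + y * h v1 v2).
Proof.
move=> gZ hZ j1 j2 j1m j2m; have [c gc] := gZ j1 j2 j1m j2m.
have [d hd] := hZ j1 j2 j1m j2m.
exists (fun p q => x * c p q + y * d p q) => v1 v2 v1j v2j; rewrite gc// hd//.
rewrite !mulr_sumr -big_split/=; apply: eq_bigr => p _.
by rewrite !mulr_sumr -big_split/=; apply: eq_bigr => q _; ring.
Qed.

End Planar.

(** * Exact quadrature for double integrals over the velocity domain *)

Section PlanarIntegrals.
Variables (R : realType) (a1 b1 a2 b2 : R) (m1 : mesh a1 b1) (m2 : mesh a2 b2).
Variables (k : nat) (xi : 'I_k.+1 -> R).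
Hypothesis xi_gauss : is_gauss_nodes xi.
Let mu := @lebesgue_measure R.

Lemma Zspace_col (g : R -> R -> R) (j1 : nat) (v1 : R) :
  Zspace m1 m2 k g -> in_cell m1 j1 v1 -> Wspace m2 k (g v1).
Proof. by move=> /Zspace_swap /Zspace_row; exact. Qed.

(** The one-dimensional rule is applied twice: the inner integral is a weighted sum of columns of
    [g], hence again piecewise polynomial in [v2]. *)
Lemma iterated_cell_quadE (g : R -> R -> R) (j1 j2 : nat) :
  (j1 < ncell m1)%N -> (j2 < ncell m2)%N -> Zspace m1 m2 k g ->
  \int[mu]_(v2 in cell m2 j2) \int[mu]_(v1 in cell m1 j1) g v1 v2
    = cell_quad m2 xi j2 (fun v2 => cell_quad m1 xi j1 (g^~ v2)).
Proof.
move=> j1m j2m gZ.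
have inner i v2 : in_cell m2 i v2 ->
    \int[mu]_(v1 in cell m1 j1) g v1 v2 = cell_quad m1 xi j1 (g^~ v2).
  by move=> v2i; rewrite (cell_quadE xi_gauss j1m (Zspace_row gZ v2i)).
rewrite (cell_quadE xi_gauss j2m).
  by apply: eq_cell_quad => // l; apply: inner; exact: gauss_pt_in_cell.
(* The identity [inner] holds only inside cells, which is all that membership in [Wspace] asks
   for. *)
apply: (Wspace_eq inner); apply: Wspace_cell_quad => l.
exact: Zspace_col gZ (gauss_pt_in_cell xi_gauss l j1m).
Qed.

Lemma Wspace_inner_integral (g : R -> R -> R) : Zspace m1 m2 k g ->
  Wspace m2 k (fun v2 => \int[mu]_(v1 in `[a1, b1]) g v1 v2).
Proof.
move=> gZ; apply: (Wspace_eq (h := fun v2 => quad m1 xi (g^~ v2))).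
  by move=> i v2 v2i; rewrite (quadE xi_gauss (Zspace_row gZ v2i)).
apply: Wspace_quad => i l im.
exact: Zspace_col gZ (gauss_pt_in_cell xi_gauss l im).
Qed.

Lemma iterated_quadE (g : R -> R -> R) : Zspace m1 m2 k g ->
  \int[mu]_(v2 in `[a2, b2]) \int[mu]_(v1 in `[a1, b1]) g v1 v2
    = quad m2 xi (fun v2 => quad m1 xi (g^~ v2)).
Proof.
move=> gZ; rewrite (quadE xi_gauss (Wspace_inner_integral gZ)).
apply: eq_quad => i l im.
by rewrite (quadE xi_gauss (Zspace_row gZ (gauss_pt_in_cell xi_gauss l im))).
Qed.

End PlanarIntegrals.

(** * Integrability and telescoping of the velocity fluxes *)

Section VelocityFlux.
Variables (R : realType) (a1 b1 a2 b2 : R) (m1 : mesh a1 b1) (m2 : mesh a2 b2).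
Variables (k : nat) (vf : vlasov_flux) (tau : R) (g : R -> R -> R).
Hypothesis gZ : Zspace m1 m2 k g.
Variable alpha : R -> R.
Hypothesis alpha_cont : continuous alpha.
Let mu := @lebesgue_measure R.
Let flux j v2 := velflux vf tau m1 (alpha v2) (g^~ v2) j.

(** At the ends of the domain the flux is zero. Elsewhere [mul_vnumflux] makes speed times flux a
    combination of [alpha] and its absolute value with traces, which agrees with a continuous
    function inside the cell. *)
Lemma velflux_integrable (j j2 : nat) : (j <= ncell m1)%N ->
  (j2 < ncell m2)%N ->
  mu.-integrable (cell m2 j2) (EFin \o (fun v2 => alpha v2 * flux j v2)).
Proof.
move=> jm j2m; rewrite /flux /velflux.
have [_|] := boolP ((j == 0%N) || (j == ncell m1)).
  under eq_fun do rewrite mulr0.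
  by apply: continuous_itv_integrable; exact: cst_continuous.
case: j jm => [//|j] jm; rewrite /= => jn.
(* Interface [j.+1] is interior: its left trace comes from cell [j], its right trace from cell
   [j.+1]. *)
have jlt : (j.+1 < ncell m1)%N by rewrite ltn_neqAle jn.
have [hl hlc hlE] := Wspace_continuous (Zspace_llim (ltnW jlt) gZ) j2m.
have [hr hrc hrE] := Wspace_continuous (Zspace_rlim jlt gZ) j2m.
have [c1 [c2 [c3 [c4 fluxE]]]] := mul_vnumflux vf tau.
apply: (@interior_integrable _ _ _ _ (fun v2 =>
    (c1 * alpha v2 + c2 * `|alpha v2|) * hl v2
    + (c3 * alpha v2 + c4 * `|alpha v2|) * hr v2)).
  have lin (c d : R) : continuous (fun v => c * alpha v + d * `|alpha v|).
    move=> v; apply: cvgD; apply: cvgM; [exact: cvg_cst|exact: alpha_cont|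
      exact: cvg_cst|].
    by apply: cvg_norm; exact: alpha_cont.
  move=> v; apply: cvgD; apply: cvgM; [exact: lin|exact: hlc|exact: lin|
    exact: hrc].
by move=> v2 v2j; rewrite fluxE hlE// hrE.
Qed.

(* The interior fluxes cancel pairwise and the two boundary fluxes are zero. *)
Lemma velflux_telescope (j2 : nat) : (j2 < ncell m2)%N ->
  \sum_(j1 < ncell m1) \int[mu]_(v2 in cell m2 j2)
    (alpha v2 * (flux j1.+1 v2 * llim (fun=> 1) (node m1 j1.+1)
                 - flux j1 v2 * rlim (fun=> 1) (node m1 j1))) = 0.
Proof.
move=> j2m.
pose G j := \int[mu]_(v2 in cell m2 j2) (alpha v2 * flux j v2).
have G0 j : (j == 0%N) || (j == ncell m1) -> G j = 0.
  move=> j0; rewrite /G; under eq_Rintegral do rewrite /flux /velflux j0 mulr0.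
  by rewrite Rintegral_cst ?mul0r//; exact: measurable_itv.
rewrite (eq_bigr (fun j1 : 'I_(ncell m1) => G j1.+1 - G j1)) => [|j1 _].
  rewrite -(big_mkord xpredT (fun j => G j.+1 - G j)) telescope_sumr//.
  by rewrite !G0 ?eqxx ?orbT// subrr.
rewrite /G -RintegralB; last 3 first.
- exact: measurable_itv.
- by apply: velflux_integrable.
- by apply: velflux_integrable => //; exact: ltnW.
by apply: eq_Rintegral => v2 _; rewrite llim_cst rlim_cst !mulr1 mulrBr.
Qed.

End VelocityFlux.

(** * Conservation in a velocity substep, stated with quadratures *)

Section Conservation.
Variables (R : realType) (L V1c V2c : R) (k : nat).
Variable D : discretization L V1c V2c k.
Let mu := @lebesgue_measure R.
Let xi := xi D.
Let gauss : is_gauss_nodes xi := xi_gauss D.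

Let quad2 (g : R -> R -> R) : R :=
  quad (m2 D) xi (fun v2 => quad (m1 D) xi (g^~ v2)).

(** The constant test function removes the volume term. What remains is [T1], telescoping in [j1]
    for each [j2], and [T2], telescoping in [j2] for each [j1]. *)
Lemma sum_Dform (tau : R) (g : R -> R -> R) (alpha1 alpha2 : R -> R) :
  Zspace (m1 D) (m2 D) k g -> continuous alpha1 -> continuous alpha2 ->
  \sum_(j1 < ncell (m1 D)) \sum_(j2 < ncell (m2 D))
    Dform D tau j1 j2 g alpha1 alpha2 (fun _ _ => 1) = 0.
Proof.
move=> gZ c1 c2.
pose F1 j v2 := velflux (vflux D) tau (m1 D) (alpha1 v2) (g^~ v2) j.
pose F2 j v1 := velflux (vflux D) tau (m2 D) (alpha2 v1) (g v1) j.
pose T1 j1 j2 := \int[mu]_(v2 in cell (m2 D) j2)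
  (alpha1 v2 * (F1 j1.+1 v2 * llim (fun=> 1) (node (m1 D) j1.+1)
                - F1 j1 v2 * rlim (fun=> 1) (node (m1 D) j1))).
pose T2 j1 j2 := \int[mu]_(v1 in cell (m1 D) j1)
  (alpha2 v1 * (F2 j2.+1 v1 * llim (fun=> 1) (node (m2 D) j2.+1)
                - F2 j2 v1 * rlim (fun=> 1) (node (m2 D) j2))).
have DformE j1 j2 :
    Dform D tau j1 j2 g alpha1 alpha2 (fun _ _ => 1) = T1 j1 j2 + T2 j1 j2.
  rewrite /Dform -/mu -[RHS]add0r addrA; congr (_ + _ + _).
  have zero v1 v2 : g v1 v2 * (alpha1 v2 * derive1 (fun=> 1 : R) v1
      + alpha2 v1 * derive1 (fun=> 1 : R) v2) = 0.
    by rewrite !derive1_cst !mulr0 addr0 mulr0.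
  rewrite (@eq_Rintegral _ _ _ mu _ (fun=> 0)) => [|v2 _].
    by rewrite Rintegral_cst ?mul0r ?oppr0//; exact: measurable_itv.
  rewrite (@eq_Rintegral _ _ _ mu _ (fun=> 0)) => [|v1 _]; last exact: zero.
  by rewrite Rintegral_cst ?mul0r//; exact: measurable_itv.
under eq_bigr do under eq_bigr do rewrite DformE.
under eq_bigr do rewrite big_split/=.
have T1sum : \sum_(j2 < ncell (m2 D)) \sum_(j1 < ncell (m1 D)) T1 j1 j2 = 0.
  by apply: big1 => j2 _; exact: (velflux_telescope (vflux D) tau gZ c1).
have T2sum : \sum_(j1 < ncell (m1 D)) \sum_(j2 < ncell (m2 D)) T2 j1 j2 = 0.
  apply: big1 => j1 _.
  exact: (velflux_telescope (vflux D) tau (Zspace_swap gZ) c2).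
clearbody T1 T2.
by rewrite big_split/= T2sum exchange_big/= T1sum addr0.
Qed.

(** The factor 1 is the constant test function, kept to match the weak form. *)
Lemma Zspace_increment (tau : R) (g h : R -> R -> R) :
  Zspace (m1 D) (m2 D) k g -> Zspace (m1 D) (m2 D) k h ->
  Zspace (m1 D) (m2 D) k (fun v1 v2 => (g v1 v2 - h v1 v2) / tau * 1).
Proof.
move=> gZ hZ; apply: (Zspace_eq _ (Zspace_lin tau^-1 (- tau^-1) gZ hZ)).
by move=> v1 v2; ring.
Qed.

(** Common core of Scheme-b and Scheme-c. The mass term is given as a quadrature, so that both
    orders of integration used by the two schemes fit. *)
Lemma velocity_substep_quad (tau : R) (g fn : R -> R -> R)
    (alpha1 alpha2 : R -> R) :
  tau != 0 -> Zspace (m1 D) (m2 D) k g -> Zspace (m1 D) (m2 D) k fn ->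
  continuous alpha1 -> continuous alpha2 ->
  (forall j1 j2, (j1 < ncell (m1 D))%N -> (j2 < ncell (m2 D))%N ->
    cell_quad (m2 D) xi j2 (fun v2 => cell_quad (m1 D) xi j1
      (fun v1 => (g v1 v2 - fn v1 v2) / tau * 1))
    + Dform D tau j1 j2 (fun v1 v2 => (g v1 v2 + fn v1 v2) / 2)
        alpha1 alpha2 (fun _ _ => 1) = 0) ->
  quad2 g = quad2 fn.
Proof.
move=> tau0 gZ fZ c1 c2 weak.
have gbarZ : Zspace (m1 D) (m2 D) k (fun v1 v2 => (g v1 v2 + fn v1 v2) / 2).
  by apply: (Zspace_eq _ (Zspace_lin 2^-1 2^-1 gZ fZ)) => v1 v2; field.
pose Q j1 j2 (h : R -> R -> R) :=
  cell_quad (m2 D) xi j2 (fun v2 => cell_quad (m1 D) xi j1 (h^~ v2)).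
have QE j1 j2 : Q j1 j2 (fun v1 v2 => (g v1 v2 - fn v1 v2) / tau * 1)
    = tau^-1 * (Q j1 j2 g - Q j1 j2 fn).
  rewrite /Q -cell_quadB -cell_quadZ; apply: eq_bigr => l _; congr (_ * _).
  rewrite -cell_quadB -cell_quadZ; apply: eq_bigr => l' _; congr (_ * _).
  by rewrite mulr1 mulrC.
have DE (j1 : 'I_(ncell (m1 D))) (j2 : 'I_(ncell (m2 D))) :
    Dform D tau j1 j2 (fun v1 v2 => (g v1 v2 + fn v1 v2) / 2)
      alpha1 alpha2 (fun _ _ => 1) = tau^-1 * (Q j1 j2 fn - Q j1 j2 g).
  have /eqP := weak j1 j2 (ltn_ord j1) (ltn_ord j2).
  rewrite addrC addr_eq0 => /eqP ->.
  by rewrite -[X in - X]/(Q j1 j2 _) QE -mulrN opprB.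
have quad2E h : quad2 h = \sum_(j1 < ncell (m1 D)) \sum_(j2 < ncell (m2 D))
    Q j1 j2 h.
  by rewrite /quad2 quad_iterated exchange_big.
(* Summing the cell equations, the vanishing total of the flux terms becomes
   [tau^-1 * (quad2 fn - quad2 g) = 0]. *)
have := sum_Dform tau gbarZ c1 c2.
under eq_bigr do under eq_bigr do rewrite DE.
under eq_bigr do rewrite -mulr_sumr sumrB.
rewrite -mulr_sumr sumrB -!quad2E => /eqP.
by rewrite mulf_eq0 invr_eq0 (negbTE tau0)/= subr_eq0 => /eqP.
Qed.

(** * Slices of the distribution function and the particle number as a triple quadrature *)

Lemma Sspace_slice_x (f : R -> R -> R -> R) (i : nat) (x : R) :
  Sspace (mx D) (m1 D) (m2 D) k f -> in_cell (mx D) i x ->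
  Zspace (m1 D) (m2 D) k (f x).
Proof.
move=> fS xi' j1 j2 j1m j2m; have [c fc] := fS i j1 j2 xi'.1 j1m j2m.
exists (fun p q => \sum_(o < k.+1) c o p q * x ^+ o) => v1 v2 v1j v2j.
rewrite fc// exchange_big/=; apply: eq_bigr => p _.
rewrite exchange_big/=; apply: eq_bigr => q _.
by rewrite !mulr_suml.
Qed.

Lemma Sspace_slice_v (f : R -> R -> R -> R) (j1 j2 : nat) (v1 v2 : R) :
  Sspace (mx D) (m1 D) (m2 D) k f -> in_cell (m1 D) j1 v1 ->
  in_cell (m2 D) j2 v2 -> Wspace (mx D) k (fun x => f x v1 v2).
Proof.
move=> fS v1j v2j i im; have [c fc] := fS i j1 j2 im v1j.1 v2j.1.
exists (\poly_(o < k.+1) \sum_(p < k.+1) \sum_(q < k.+1)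
  c (inord o) p q * v1 ^+ p * v2 ^+ q); split=> [|x xj]; first exact: size_poly.
rewrite fc// horner_poly; apply: eq_bigr => o _; rewrite mulr_suml.
apply: eq_bigr => p _; rewrite mulr_suml; apply: eq_bigr => q _.
by rewrite inord_val; ring.
Qed.

Lemma particle_numberE (f : R -> R -> R -> R) :
  Sspace (mx D) (m1 D) (m2 D) k f ->
  particle_number L V1c V2c f = quad (mx D) xi (fun x => quad2 (f x)).
Proof.
move=> fS; rewrite /particle_number -/mu.
have inner i x : in_cell (mx D) i x ->
    \int[mu]_(v2 in `[- V2c, V2c]) \int[mu]_(v1 in `[- V1c, V1c]) f x v1 v2
    = quad2 (f x).
  by move=> xj; exact: (iterated_quadE gauss (Sspace_slice_x fS xj)).
rewrite (quadE (m := mx D) gauss).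
  by apply: eq_quad => i l im; apply: inner; exact: gauss_pt_in_cell.
apply: (Wspace_eq inner); apply: Wspace_quad => j2 l2 j2m.
apply: Wspace_quad => j1 l1 j1m.
by apply: (Sspace_slice_v fS); exact: gauss_pt_in_cell.
Qed.

(** * Conservation for each substep and for compositions *)

Definition conserves (r : state R -> state R -> Prop) : Prop :=
  forall s s', r s s' ->
  particle_number L V1c V2c (dist_f s') = particle_number L V1c V2c (dist_f s).

Lemma scheme_a_conserves (tau : R) : tau != 0 -> conserves (scheme_a D tau).
Proof.
move=> tau0 s s' [[fS _ _] [f'S _ _] _ step].
rewrite !particle_numberE// /quad2.
(* Scheme-a gives one transport problem per velocity Gauss point, so the quadrature in [x2] is moved
   innermost. *)
rewrite [LHS]quad_swap [RHS]quad_swap; apply: eq_quad => j2 n2 j2m.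
rewrite [LHS]quad_swap [RHS]quad_swap; apply: eq_quad => j1 n1 j1m.
have [g [gW weak nodal]] := step j1 j2 n1 n2 j1m j2m.
transitivity (quad (mx D) xi g).
  by apply: eq_quad => i l im; exact: nodal.
set a := gauss_pt (m2 D) _ j2 n2 in weak nodal *.
set fn := fun x => dist_f s x _ _.
have fnW : Wspace (mx D) k fn.
  by apply: (Sspace_slice_v fS); exact: gauss_pt_in_cell.
pose ag x := a * ((g x + fn x) / 2).
pose F i := vnumflux (vflux D) tau a (per_llim (mx D) ag i)
  (per_rlim (mx D) ag i).
(* Testing with 1 leaves only the difference of the two interface fluxes of the cell. *)
have cellE i : (i < ncell (mx D))%N -> tau^-1 *
    (cell_quad (mx D) xi i g - cell_quad (mx D) xi i fn) = F i - F i.+1.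
  move=> im; have : \int[mu]_(x in cell (mx D) i) ((g x - fn x) / tau * 1)
      - \int[mu]_(x in cell (mx D) i) (ag x * derive1 (fun=> 1 : R) x)
      + F i.+1 * llim (fun=> 1) (node (mx D) i.+1)
      - F i * rlim (fun=> 1) (node (mx D) i) = 0.
    exact: weak i (fun=> 1) im (@Wspace_cst _ _ _ _ _ 1).
  rewrite llim_cst rlim_cst !mulr1.
  have -> : \int[mu]_(x in cell (mx D) i) (ag x * derive1 (fun=> 1 : R) x) = 0.
    under eq_Rintegral do rewrite derive1_cst mulr0.
    by rewrite Rintegral_cst ?mul0r//; exact: measurable_itv.
  rewrite (cell_quadE gauss im); last first.
    apply: (Wspace_eq (h := fun x => tau^-1 * g x + (- tau^-1) * fn x)).
      by move=> j x _; rewrite /fn; ring.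
    by apply: WspaceD; exact: WspaceZ.
  rewrite -cell_quadB -cell_quadZ subr0 -addrA => /eqP.
  rewrite addr_eq0 opprB => /eqP <-; apply: eq_bigr => l _.
  by congr (_ * _); ring.
have : \sum_(i < ncell (mx D)) tau^-1 *
    (cell_quad (mx D) xi i g - cell_quad (mx D) xi i fn) = 0.
  rewrite (eq_bigr (fun i : 'I_(ncell (mx D)) => - (F i.+1 - F i))); last first.
    by move=> i _; rewrite cellE// opprB.
  rewrite sumrN -(big_mkord xpredT (fun i => F i.+1 - F i)) telescope_sumr//.
  (* Periodicity: at both ends the left limit is taken at the last node and the right limit at node
     0. *)
  have -> : F 0%N = F (ncell (mx D)).
    by rewrite /F /per_llim /per_rlim !eqxx !if_same.
  by rewrite subrr oppr0.
rewrite -mulr_sumr sumrB => /eqP.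
by rewrite mulf_eq0 invr_eq0 (negbTE tau0)/= subr_eq0 => /eqP.
Qed.

Lemma scheme_b_conserves (tau : R) : tau != 0 -> conserves (scheme_b D tau).
Proof.
move=> tau0 s s' [[fS _ _] [f'S _ _] _ step].
rewrite !particle_numberE//; apply: eq_quad => i l im.
have [g [E1 [E2 [gZ weak _ nodal _]]]] := step i l im.
have xl := gauss_pt_in_cell gauss l im.
have fZ := Sspace_slice_x fS xl.
transitivity (quad2 g).
  (* Quadrature sees only Gauss points, where the new state agrees with [g]. *)
  apply: eq_quad => j2 n2 j2m; apply: eq_quad => j1 n1 j1m; exact: nodal.
set x := gauss_pt _ _ i l in xl fZ weak *.
apply: (velocity_substep_quad tau0 gZ fZ
    (alpha1 := fun=> (field_E1 s x + E1) / 2)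
    (alpha2 := fun=> (field_E2 s x + E2) / 2));
  [exact: cst_continuous|exact: cst_continuous|move=> j1 j2 j1m j2m].
rewrite -(iterated_cell_quadE gauss j1m j2m (Zspace_increment tau gZ fZ)).
by apply: (weak j1 j2 (fun _ _ => 1)) => //; exact: Zspace_cst.
Qed.

Lemma scheme_c_conserves (tau : R) : tau != 0 -> conserves (scheme_c D tau).
Proof.
move=> tau0 s s' [[fS _ _] [f'S _ _] _ _ step].
rewrite !particle_numberE//; apply: eq_quad => i l im.
have [g [gZ weak nodal]] := step i l im.
have xl := gauss_pt_in_cell gauss l im.
have fZ := Sspace_slice_x fS xl.
transitivity (quad2 g).
  apply: eq_quad => j2 n2 j2m; apply: eq_quad => j1 n1 j1m; exact: nodal.
(* At a fixed Gauss point in [x2] the Maxwell solve enters only through the number [b], so both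
   speeds are continuous in velocity. *)
set b := (_ + _) / 2 in weak.
apply: (velocity_substep_quad tau0 gZ fZ (alpha1 := fun v2 => v2 * b)
  (alpha2 := fun v1 => - v1 * b)) => [||j1 j2 j1m j2m].
- by move=> v; apply: cvgM; [exact: cvg_id|exact: cvg_cst].
- by move=> v; apply: cvgM; [apply: cvgN; exact: cvg_id|exact: cvg_cst].
(* The mass term of Scheme-c has [v2] as its inner variable, unlike that of Scheme-b. *)
rewrite cell_quad_swap.
rewrite -(iterated_cell_quadE gauss j2m j1m
  (Zspace_swap (Zspace_increment tau gZ fZ))).
by apply: (weak j1 j2 (fun _ _ => 1)) => //; exact: Zspace_cst.
Qed.

Lemma then_step_conserves (r r' : state R -> state R -> Prop) :
  conserves r -> conserves r' -> conserves (then_step r r').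
Proof. by move=> rc rc' s s' [t [/rc <- /rc' ->]]. Qed.

Lemma scheme5_conserves (tau : R) : tau != 0 -> conserves (scheme5 D tau).
Proof.
move=> tau0; have tau20 : tau / 2 != 0 by rewrite mulf_neq0.
have ca := scheme_a_conserves tau20; have cb := scheme_b_conserves tau20.
have cc := scheme_c_conserves tau0.
apply: (then_step_conserves ca).
apply: (then_step_conserves cb).
apply: (then_step_conserves cc).
exact: then_step_conserves cb ca.
Qed.

End Conservation.

(** * Nonzero step sizes of the composed scheme, and the final statement *)

Lemma beta1_gt (R : realType) : 1 / 2 < beta1 R.
Proof.
have p : 0 < (2 : R) `^ (3^-1) by rewrite powR_gt0.
have q : 0 < (2 : R) `^ (- 3^-1) by rewrite powR_gt0.
by rewrite /beta1; lra.
Qed.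

Unset Implicit Arguments.

Theorem theorem3p4 (R : realType) (L V1c V2c : R)
    (hL : 0 < L) (hV1 : 0 < V1c) (hV2 : 0 < V2c)
    (k : nat) (D : discretization L V1c V2c k)
    (dt : R) (hdt : 0 < dt) (s s' : state R) :
  (scheme5 D dt s s' ->
     particle_number L V1c V2c (dist_f s')
     = particle_number L V1c V2c (dist_f s)) /\
  (scheme5F D dt s s' ->
     particle_number L V1c V2c (dist_f s')
     = particle_number L V1c V2c (dist_f s)).
Proof.
have dt0 : dt != 0 by rewrite gt_eqF.
have b1 := beta1_gt R.
split; first exact: scheme5_conserves.
have c1 : conserves L V1c V2c (scheme5 D (beta1 R * dt)).
  by apply: scheme5_conserves; rewrite mulf_neq0// gt_eqF//; lra.
(* From [beta1 > 1/2] the factor [beta2 = 1 - 2 * beta1] is negative, hence the step is nonzero,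
   which is all that substep conservation asks. *)
have c2 : conserves L V1c V2c (scheme5 D (beta2 R * dt)).
  by apply: scheme5_conserves; rewrite mulf_neq0// lt_eqF// /beta2; lra.
(* [beta3] is [beta1] by definition, so [c1] also serves the third step. *)
by apply: (then_step_conserves c1 (then_step_conserves c2 c1)).
Qed.
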